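(* Let $g:[0,1]\to[0,1]$ be a piecewise linear unimodal map, and let $\psi:[0,1]\to[0,1]$ be a piecewise linear non-constant map such that $\psi\circ g=g\circ\psi$. If $\psi$ has $2t$ maximal intervals of monotonicity (for some $t\in\mathbb{N}$, $t\ge 1$), then there exists a non-constant piecewise linear map $\widetilde\psi:[0,1]\to[0,1]$ which has $t$ maximal intervals of monotonicity and satisfies $\widetilde\psi\circ g=g\circ\widetilde\psi$.
   Context: A continuous map $g:[0,1]\to[0,1]$ is called unimodal if there is $v\in(0,1)$ such that $g$ is (strictly) increasing on $[0,v]$, (strictly) decreasing on $[v,1]$, and $g(0)=g(1)=0$, $g(v)=1$. Piecewise linear means continuous and affine on each of finitely many intervals whose union is $[0,1]$. A maximal interval of monotonicity of a map is a subinterval of $[0,1]$ on which the map is monotone and which is not properly contained in a larger interval with this property. *)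

(* Defs.v *)
From HB Require Import structures.
From mathcomp Require Import all_boot all_order all_algebra.
From mathcomp Require Import all_classical all_reals all_analysis.

Set Implicit Arguments.
Unset Strict Implicit.
Unset Printing Implicit Defensive.

Import Order.TTheory GRing.Theory Num.Theory.
Import numFieldNormedType.Exports.

Local Open Scope classical_set_scope.
Local Open Scope ring_scope.

(* A map from [0, 1] to itself is represented by a total function f : R -> R
   sending [0, 1] into itself. Every condition below only constrains the values
   of f on [0, 1]; its values elsewhere are irrelevant. *)

Definition self_map01 (R : realType) (f : R -> R) : Prop :=
  set_fun `[0, 1] `[0, 1] f.

Definition unimodal (R : realType) (g : R -> R) : Prop :=
  self_map01 g /\ {within `[0, 1], continuous g} /\
  exists2 v : R, 0 < v < 1 &
    [/\ {in `[0, v] &, {homo g : x y / x < y}},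
        {in `[v, 1] &, {homo g : x y / x < y >-> y < x}},
        g 0 = 0, g 1 = 0 & g v = 1].

Definition affine_on (R : realType) (I : set R) (f : R -> R) : Prop :=
  exists a b : R, forall x, I x -> f x = a * x + b.

Definition piecewise_linear (R : realType) (f : R -> R) : Prop :=
  {within `[0, 1], continuous f} /\
  exists (n : nat) (I : 'I_n -> set R),
    [/\ forall i, is_interval (I i),
        forall i, affine_on (I i) f &
        \bigcup_i I i = `[0, 1]%classic].

Definition nonconstant01 (R : realType) (f : R -> R) : Prop :=
  ~ exists c : R, forall x, `[0, 1]%classic x -> f x = c.

Definition monotone_on (R : realType) (I : set R) (f : R -> R) : Prop :=
  {in I &, nondecreasing_fun f} \/
  {in I &, nonincreasing_fun f}.

Definition monotonicity_interval (R : realType) (f : R -> R) (I : set R)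
    : Prop :=
  [/\ is_interval I, I `<=` `[0, 1]%classic & monotone_on I f].

Definition maximal_monotonicity_intervals (R : realType) (f : R -> R)
    : set (set R) :=
  [set I | monotonicity_interval f I /\
     forall J, monotonicity_interval f J -> ~ I `<` J].

Definition commute01 (R : realType) (f g : R -> R) : Prop :=
  {in `[0, 1], f \o g =1 g \o f}.

(* Main.v *)
Require Import Defs.
From mathcomp Require Import all_boot all_order all_algebra.
From mathcomp Require Import all_classical all_reals all_analysis.
From mathcomp Require Import ring lra zify.

Set Implicit Arguments.
Unset Strict Implicit.
Unset Printing Implicit Defensive.

Import Order.TTheory GRing.Theory Num.Theory.
Import numFieldNormedType.Exports.

Local Open Scope classical_set_scope.
Local Open Scope ring_scope.

(** Let v be the peak of g, and let l and r be the inverses of the increasing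
branch of g on [0, v] and of the decreasing branch on [v, 1]. The new map is
psi' = psi \o l. Everything follows once psi takes the same value at the two
g-preimages l y and r y of each y, for then psi = psi' \o g: commutation passes
from psi to psi' because g is onto, and the laps of psi over [0, v], which are
half of all its laps, become those of psi'.

The symmetry psi (l y) = psi (r y) needs two facts about psi.

First, psi is constant on no interval ([nowhere_flat]). Since psi \o g =
g \o psi and the fibers of g are discrete, the set of points near which psi is
locally constant is stable under g and under preimages by g, and its boundary is
stable under l and r. This boundary is finite because psi is piecewise linear,
while a finite set stable under both l and r is empty ([stable_finite_empty]).
Hence the set is empty or everything, and psi is not constant. So psi is a
[zigzag]: there are points 0 = a 0 < ... < a k = 1 between which it is strictly
monotone in alternating directions, and its maximal intervals of monotonicity
are exactly these k laps ([zigzag_card]).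

Secondly, psi \o g is a zigzag with k + k laps, whose points
c 0 < ... < c (k + k) are the l (a i) followed by the r (a i) in reverse order
([fold_zigzag]). It equals g \o psi, and inside a lap of psi the map g \o psi
can turn only where psi passes through v, so at most once. As g \o psi turns
k + k - 1 times, this forces c (2 j) = a j and psi (c (2 j + 1)) = v
([fold_even], [fold_odd]).

Now let k = 2 t. Then v = c k = a t. By parity, psi lies on the same side of v
on the lap of l y and on the mirror lap of r y, and psi (l y) and psi (r y) have
the same image psi y under g. Since g is injective on each side of v, they are
equal ([even_fold_symmetric]). *)

(** * Inverse branches of a unimodal map *)

(** Epsilon-delta form of continuity within [a, b], for explicit estimates near a
point. *)
Definition cont_on (R : realType) (a b : R) (f : R -> R) : Prop :=
  forall x, a <= x <= b -> forall e, 0 < e ->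
  exists2 d, 0 < d &
    forall y, a <= y <= b -> `|y - x| < d -> `|f y - f x| < e.

Lemma cont_onP (R : realType) (a b : R) (f : R -> R) :
  {within `[a, b], continuous f} <-> cont_on a b f.
Proof.
rewrite subspace_continuousP; split=> [fc x xab e e0 | fc x].
- have /(_ x) := fc; rewrite /= in_itv /= => /(_ xab)/cvgrPdist_lt/(_ _ e0).
  rewrite near_withinE => -[d /= d0 H]; exists d => // y yab yx.
  by rewrite distrC; apply: H => /=; rewrite ?in_itv //= distrC.
- rewrite /= in_itv /= => xab; apply/cvgrPdist_lt => e e0.
  have [d d0 H] := fc x xab e e0.
  rewrite near_withinE; exists d => //= y yx; rewrite in_itv /= => yab.
  by rewrite distrC; apply: H => //; rewrite distrC.
Qed.

Lemma cont_on_comp (R : realType) (a b c d : R) (f h : R -> R) :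
  cont_on a b f -> cont_on c d h -> (forall x, c <= x <= d -> a <= h x <= b) ->
  cont_on c d (f \o h).
Proof.
move=> fc hc hI x xcd e e0.
have [u u0 fu] := fc _ (hI _ xcd) e e0.
have [w w0 hw] := hc _ xcd u u0.
by exists w => // y ycd yx; apply: fu; [apply: hI | apply: hw].
Qed.

(** The peak v of g, the inverses l and r of its two monotone branches, and what
the proof uses about them. *)
Record branches (R : realType) (g : R -> R) (v : R) (l r : R -> R) : Prop :=
  Branches {
    peak01 : 0 < v < 1;
    peak_val : g v = 1;
    g_zero : g 0 = 0;
    g_one : g 1 = 0;
    g_in : forall x, 0 <= x <= 1 -> 0 <= g x <= 1;
    g_cont : cont_on 0 1 g;
    g_incr : forall x y, 0 <= x -> x < y -> y <= v -> g x < g y;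
    g_decr : forall x y, v <= x -> x < y -> y <= 1 -> g y < g x;
    left_in : forall y, 0 <= y <= 1 -> 0 <= l y <= v;
    right_in : forall y, 0 <= y <= 1 -> v <= r y <= 1;
    left_inv : forall y, 0 <= y <= 1 -> g (l y) = y;
    right_inv : forall y, 0 <= y <= 1 -> g (r y) = y;
    left_g : forall x, 0 <= x <= v -> l (g x) = x;
    right_g : forall x, v <= x <= 1 -> r (g x) = x;
    left_incr : forall x y, 0 <= x -> x < y -> y <= 1 -> l x < l y;
    right_decr : forall x y, 0 <= x -> x < y -> y <= 1 -> r y < r x;
    left_cont : cont_on 0 1 l;
    right_cont : cont_on 0 1 r }.

Lemma unimodal_branches (R : realType) (g : R -> R) :
  unimodal g -> exists v l r, branches g v l r.
Proof.
move=> [gI [/cont_onP gc [v v01 [gup gdn g0 g1 gv]]]].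
have gI' x : 0 <= x <= 1 -> 0 <= g x <= 1.
  by move=> x01; have := gI x; rewrite /= !in_itv /=; apply.
have gup' x y : 0 <= x -> x < y -> y <= v -> g x < g y.
  move=> x0 xy yv; apply: gup; rewrite ?in_itv //=; lra.
have gdn' x y : v <= x -> x < y -> y <= 1 -> g y < g x.
  move=> x0 xy yv; apply: gdn; rewrite ?in_itv //=; lra.
have sub a b : 0 <= a -> b <= 1 -> {within `[a, b], continuous g}.
  move=> a0 b1; apply/cont_onP => x xab e e0.
  have [|d d0 H] := gc x _ e e0; first lra.
  by exists d => // y yab; apply: H; lra.
have surl y : exists x, 0 <= y <= 1 -> 0 <= x <= v /\ g x = y.
  have [y01|/negP ny] := boolP (0 <= y <= 1); last by exists 0.
  have [||||c] := @IVT R g 0 v y _ (sub _ _ _ _); try lra.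
    by rewrite g0 gv minEle maxEle ler01.
  by rewrite in_itv /= => cv gcy; exists c.
have surr y : exists x, 0 <= y <= 1 -> v <= x <= 1 /\ g x = y.
  have [y01|/negP ny] := boolP (0 <= y <= 1); last by exists 0.
  have [||||c] := @IVT R g v 1 y _ (sub _ _ _ _); try lra.
    by rewrite g1 gv minEle maxEle ler10.
  by rewrite in_itv /= => cv gcy; exists c.
have [l lP] := choice surl; have [r rP] := choice surr.
have lI y : 0 <= y <= 1 -> 0 <= l y <= v by case/lP.
have rI y : 0 <= y <= 1 -> v <= r y <= 1 by case/rP.
have gl y : 0 <= y <= 1 -> g (l y) = y by case/lP.
have gr y : 0 <= y <= 1 -> g (r y) = y by case/rP.
have lg x : 0 <= x <= v -> l (g x) = x.
  move=> xv; have gx : 0 <= g x <= 1 by apply: gI'; lra.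
  have := lI _ gx; have := gl _ gx.
  case: (ltgtP (l (g x)) x) => // lt E lv.
  - have := @gup' (l (g x)) x; lra.
  - have := @gup' x (l (g x)); lra.
have rg x : v <= x <= 1 -> r (g x) = x.
  move=> xv; have gx : 0 <= g x <= 1 by apply: gI'; lra.
  have := rI _ gx; have := gr _ gx.
  case: (ltgtP (r (g x)) x) => // lt E lv.
  - have := @gdn' (r (g x)) x; lra.
  - have := @gdn' x (r (g x)); lra.
have linc x y : 0 <= x -> x < y -> y <= 1 -> l x < l y.
  move=> x0 xy y1; rewrite ltNge; apply/negP => le.
  have [x01 y01] : 0 <= x <= 1 /\ 0 <= y <= 1 by lra.
  have := gl _ x01; have := gl _ y01; have := lI _ x01; have := lI _ y01.
  move: le; rewrite le_eqVlt => /orP[/eqP->|lt]; first lra.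
  have := @gup' (l y) (l x); lra.
have rdec x y : 0 <= x -> x < y -> y <= 1 -> r y < r x.
  move=> x0 xy y1; rewrite ltNge; apply/negP => le.
  have [x01 y01] : 0 <= x <= 1 /\ 0 <= y <= 1 by lra.
  have := gr _ x01; have := gr _ y01; have := rI _ x01; have := rI _ y01.
  move: le; rewrite le_eqVlt => /orP[/eqP->|lt]; first lra.
  have := @gdn' (r x) (r y); lra.
have l0 : l 0 = 0 by rewrite -g0 lg ?g0 //; lra.
have l1 : l 1 = v by rewrite -gv lg //; lra.
have r0 : r 0 = 1 by rewrite -g1 rg //; lra.
have r1 : r 1 = v by rewrite -gv rg //; lra.
have lc : cont_on 0 1 l.
  apply/cont_onP/segment_inc_surj_continuous.
  - apply: le_mono_in => x y; rewrite !in_itv /= => *; apply: linc; lra.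
  - rewrite l0 l1 => x; rewrite /= in_itv /= => xv; exists (g x).
      by rewrite /= in_itv /=; apply: gI'; lra.
    exact: lg.
have rc : cont_on 0 1 r.
  apply/cont_onP/segment_dec_surj_continuous.
  - apply: le_nmono_in => x y; rewrite !in_itv /= => *; apply: rdec; lra.
  - rewrite r0 r1 => x; rewrite /= in_itv /= => xv; exists (g x).
      by rewrite /= in_itv /=; apply: gI'; lra.
    exact: rg.
by exists v, l, r; split.
Qed.

Lemma left_le (R : realType) (g l r : R -> R) (v x z : R) :
  branches g v l r -> 0 <= x -> x <= z -> z <= 1 -> l x <= l z.
Proof.
move=> br; rewrite (le_eqVlt x) => x0 /orP[/eqP->//|xz] z1.
exact/ltW/(left_incr br).
Qed.

Lemma right_le (R : realType) (g l r : R -> R) (v x z : R) :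
  branches g v l r -> 0 <= x -> x <= z -> z <= 1 -> r z <= r x.
Proof.
move=> br; rewrite (le_eqVlt x) => x0 /orP[/eqP->//|xz] z1.
exact/ltW/(right_decr br).
Qed.

(** * Break points of piecewise linear maps *)

Lemma small_pos3 (R : realFieldType) (a b c : R) : 0 < a -> 0 < b -> 0 < c ->
  exists d, [/\ 0 < d, d < a, d < b & d < c].
Proof.
move=> a0 b0 c0; pose m := Num.min a (Num.min b c).
have m0 : 0 < m by rewrite !lt_min a0 b0.
have [ma mb mc] : [/\ m <= a, m <= b & m <= c] by rewrite !ge_min !lexx !orbT.
by exists (m / 2); split; lra.
Qed.

Lemma affine_cont (R : realType) (p q a b : R) : cont_on p q (fun x => a * x + b).
Proof.
apply/cont_onP/continuous_subspaceT => x; apply: cvgD; last exact: cvg_cst.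
by apply: cvgM; [exact: cvg_cst | exact: cvg_id].
Qed.

Lemma cont_eq_closure (R : realType) (p q : R) (f h : R -> R) (x y : R) :
  cont_on p q f -> cont_on p q h -> p <= x -> x < y -> y <= q ->
  (forall z, x < z < y -> f z = h z) -> forall z, x <= z <= y -> f z = h z.
Proof.
move=> fc hc px xy yq fh z zxy.
apply/eqP; rewrite -subr_eq0 -normr_le0 leNgt; apply/negP => n0.
have e0 : 0 < `|f z - h z| / 2 by lra.
have zpq : p <= z <= q by lra.
have [d1 d10 F] := fc z zpq _ e0; have [d2 d20 H] := hc z zpq _ e0.
suff [w [wxy w1 w2]] : exists w, [/\ x < w < y, `|w - z| < d1 & `|w - z| < d2].
  have wpq : p <= w <= q by lra.
  have := F w wpq w1; have := H w wpq w2; rewrite -(fh w wxy) => A B.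
  have : `|f z - h z| <= `|f w - h z| + `|f w - f z|.
    by have := ler_distD (f w) (f z) (h z); rewrite (distrC (f z) (f w)); lra.
  lra.
have [zm|mz] := leP z ((x + y) / 2).
- have [d [d0 dl1 dl2 dl3]] : exists d, [/\ 0 < d, d < d1, d < d2 & d < (y - x) / 2].
    by apply: small_pos3; lra.
  by exists (z + d); split; rewrite ?(addrC z) ?addrK ?gtr0_norm //; lra.
- have [d [d0 dl1 dl2 dl3]] : exists d, [/\ 0 < d, d < d1, d < d2 & d < (y - x) / 2].
    by apply: small_pos3; lra.
  exists (z - d); split; rewrite ?(addrC z) ?addrK ?normrN ?gtr0_norm //; lra.
Qed.

(** The break points are the end points of the pieces. A piece that contains the
midpoint between two consecutive break points has no end point between them, so
it contains the whole open interval, and affinity extends to the closed one by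
continuity. *)
Lemma piecewise_linear_breaks (R : realType) (f : R -> R) :
  piecewise_linear f -> exists n (e : nat -> R),
  [/\ e 0%N = 0, e n = 1, forall i, (i <= n)%N -> 0 <= e i <= 1,
      forall i, (i < n)%N -> e i < e i.+1 &
      forall i, (i < n)%N -> exists a b,
        forall x, e i <= x <= e i.+1 -> f x = a * x + b].
Proof.
move=> [/cont_onP fc [m [I [Iint Iaff Icov]]]].
have I01 i x : I i x -> 0 <= x <= 1.
  move=> Ix; have : (\bigcup_i I i) x by exists i.
  by rewrite Icov /= in_itv.
pose ends := [seq inf (I i) | i <- enum 'I_m] ++ [seq sup (I i) | i <- enum 'I_m].
pose E : seq R := sort <=%R (undup [seq x <- 0 :: 1 :: ends | 0 <= x <= 1]).
have memE x : (x \in E) = (0 <= x <= 1) && (x \in 0 :: 1 :: ends).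
  by rewrite mem_sort mem_undup mem_filter.
have sE : sorted <%R E by rewrite sort_lt_sorted undup_uniq.
have E0 : 0 \in E by rewrite memE !inE eqxx /=; lra.
have E1 : 1 \in E by rewrite memE !inE eqxx orbT andbT /=; lra.
have lt_nth i j : (i < size E)%N -> (j < size E)%N ->
    (nth 0 E i < nth 0 E j) = (i < j)%N.
  by move=> iE jE; rewrite (lt_sorted_ltn_nth 0 sE) ?inE.
have Esz : (0 < size E)%N by case: (E) E0.
have E01 i : (i < size E)%N -> 0 <= nth 0 E i <= 1.
  by move=> /(mem_nth 0); rewrite memE => /andP[].
exists (size E).-1, (nth 0 E); split.
- have iE := E0; rewrite -index_mem in iE.
  have := E01 0%N Esz; have [z|pos] := posnP (index 0 E).
    by rewrite -z nth_index.
  have : nth 0 E 0 < nth 0 E (index 0 E) by rewrite lt_nth.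
  by rewrite nth_index //; lra.
- have iE := E1; rewrite -index_mem in iE.
  have lE : ((size E).-1 < size E)%N by rewrite prednK.
  have := E01 (size E).-1 lE; have [ii|ni] := ltnP (index 1 E) (size E).-1.
    have : nth 0 E (index 1 E) < nth 0 E (size E).-1 by rewrite lt_nth.
    by rewrite nth_index //; lra.
  suff <- : index 1 E = (size E).-1 by rewrite nth_index.
  by apply/eqP; rewrite eqn_leq ni -ltnS prednK // iE.
- by move=> i ni; apply: E01; lia.
- by move=> i ni; rewrite lt_nth //; lia.
- move=> i ni; have i1 : (i < size E)%N by lia.
  have i2 : (i.+1 < size E)%N by lia.
  have xy : nth 0 E i < nth 0 E i.+1 by rewrite lt_nth.
  have nE z : nth 0 E i < z < nth 0 E i.+1 -> z \notin E.
    move=> zz; apply/negP => zE; move: zz; rewrite -(nth_index 0 zE).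
    by rewrite !lt_nth ?index_mem //; lia.
  move: (E01 i i1) (E01 _ i2) xy nE; set x := nth 0 E i; set y := nth 0 E i.+1.
  move=> x01 y01 xy nE.
  have : (\bigcup_i I i) ((x + y) / 2).
    by rewrite Icov /= in_itv /=; lra.
  case=> j _ Ij.
  have hl : has_lbound (I j) by exists 0 => z /I01; lra.
  have hu : has_ubound (I j) by exists 1 => z /I01; lra.
  have nonE : I j !=set0 by exists ((x + y) / 2).
  have infE : inf (I j) \in ends.
    by rewrite mem_cat; apply/orP; left; apply/mapP; exists j; rewrite ?mem_enum.
  have supE : sup (I j) \in ends.
    by rewrite mem_cat; apply/orP; right; apply/mapP; exists j; rewrite ?mem_enum.
  have noend z : z \in ends -> ~ x < z < y.
    move=> zE h; have := nE _ h; rewrite memE => /negP; apply.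
    by rewrite !inE zE !orbT andbT; lra.
  have infn := noend _ infE; have supn := noend _ supE.
  have infm : inf (I j) <= (x + y) / 2 by apply: ge_inf.
  have supm : (x + y) / 2 <= sup (I j) by apply: ub_le_sup.
  have sub z : x < z < y -> I j z.
    move=> zxy.
    have [|w1 Iw1 w1z] := @inf_adherent _ (I j) (z - inf (I j)) _ (conj nonE hl); first lra.
    have [|w2 Iw2 zw2] := @sup_adherent _ (I j) (sup (I j) - z) _ (conj nonE hu); first lra.
    by apply: (Iint j w1 w2) => //; lra.
  have [a [b ab]] := Iaff j; exists a, b.
  have [x0 y1] : 0 <= x /\ y <= 1 by clear -x01 y01; lra.
  have fab z : x < z < y -> f z = a * z + b by move/sub/ab.
  exact: cont_eq_closure fc (@affine_cont R 0 1 a b) x0 xy y1 fab.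
Qed.

(** * Zigzag maps and their laps *)

(** The direction is a boolean, [true] meaning decreasing, so that alternation can
be expressed by parity. *)
Definition strict_mono (R : realType) (c : bool) (f : R -> R) (x y : R) : Prop :=
  forall u w, x <= u -> u < w -> w <= y -> if c then f w < f u else f u < f w.

(** A map whose strictly monotone laps alternate in direction: every a i with
0 < i < k is a genuine turning point, and k is the number of laps. *)
Record zigzag (R : realType) (f : R -> R) (p q : R) (k : nat) (a : nat -> R)
    (b : bool) : Prop := Zigzag {
  zz_pos : (0 < k)%N;
  zz_start : a 0%N = p;
  zz_stop : a k = q;
  zz_lt : forall i, (i < k)%N -> a i < a i.+1;
  zz_mono : forall i, (i < k)%N -> strict_mono (b (+) odd i) f (a i) (a i.+1) }.

Lemma strict_mono_glue (R : realType) (c : bool) (f : R -> R) (x y z : R) :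
  strict_mono c f x y -> strict_mono c f y z -> strict_mono c f x z.
Proof.
move=> fxy fyz u w xu uw wz.
have [wy|yw] := leP w y; first exact: fxy.
have [yu|uy] := leP y u; first exact: fyz.
have := fxy u y xu uy (lexx y); have := fyz y w (lexx y) yw wz.
by case: (c) => *; lra.
Qed.

Lemma zigzag_snoc (R : realType) (f : R -> R) (p q z : R) k a b d :
  zigzag f p q k a b -> q < z -> strict_mono d f q z ->
  exists k' a' b', zigzag f p z k' a' b'.
Proof.
move=> [k0 a0 ak alt am] qz fqz.
case: (eqVneq d (b (+) odd k.-1)) => [E|nE].
- exists k, (fun i => if i == k then z else a i), b; split=> //.
  + by rewrite eq_sym (gtn_eqF k0).
  + by rewrite eqxx.
  + move=> i ik; rewrite (ltn_eqF ik); have := alt i ik.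
    by case: eqP => // ->; rewrite ak => ?; lra.
  + move=> i ik; rewrite (ltn_eqF ik); have := am i ik.
    case: eqP => // ik1; rewrite ik1 ak => /strict_mono_glue; apply.
    by rewrite (_ : i = k.-1) -?E // -ik1.
- exists k.+1, (fun i => if i == k.+1 then z else a i), b; split=> //.
  + by rewrite eqxx.
  + move=> i ik; rewrite (ltn_eqF ik) eqSS; case: eqP => [->|/eqP ne]; first by rewrite ak.
    by apply: alt; lia.
  + move=> i ik; rewrite (ltn_eqF ik) eqSS; case: eqP => [->|/eqP ne].
      rewrite ak; suff -> : b (+) odd k = d by [].
      by move: nE; rewrite -[in odd k](prednK k0) /=; case: d {fqz}; case: (b); case: odd.
    by apply: am; lia.
Qed.

(** Neighbouring pieces in the same direction are merged into one lap. *)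
Lemma zigzag_of_pieces (R : realType) (f : R -> R) (n : nat) (e : nat -> R) :
  (0 < n)%N -> (forall i, (i < n)%N -> e i < e i.+1) ->
  (forall i, (i < n)%N -> exists c, strict_mono c f (e i) (e i.+1)) ->
  exists k a b, zigzag f (e 0%N) (e n) k a b.
Proof.
elim: n => // n IH _ elt em; case: (posnP n) => [n0|n0].
  have [c fc] := em n (ltnSn n); subst n.
  exists 1%N, e, c; split=> // -[|i] // _.
  by rewrite addbF.
have [c fc] := em n (ltnSn n).
have [i ni|i ni|k [a [b zz]]] := IH n0; [by apply: elt; lia|by apply: em; lia|].
by apply: (zigzag_snoc zz _ fc); apply: elt.
Qed.

Section ZigzagTheory.
Variables (R : realType) (f : R -> R) (p q : R) (k : nat) (a : nat -> R).
Variable b : bool.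
Hypothesis zz : zigzag f p q k a b.

Lemma zigzag_ltn i j : (i < j)%N -> (j <= k)%N -> a i < a j.
Proof.
elim: j => // j IH; rewrite ltnS leq_eqVlt => /orP[/eqP->|ij] jk.
  exact: zz_lt zz _ _.
by apply: lt_trans (IH ij (ltnW jk)) _; apply: zz_lt zz _ _.
Qed.

Lemma zigzag_leq i j : (i <= j)%N -> (j <= k)%N -> a i <= a j.
Proof. by rewrite leq_eqVlt => /orP[/eqP->//|ij] jk; apply/ltW/zigzag_ltn. Qed.

Lemma zigzag_bounds i : (i <= k)%N -> p <= a i <= q.
Proof.
by move=> ik; rewrite -(zz_start zz) -(zz_stop zz) !zigzag_leq.
Qed.

Lemma zigzag_locate x : p <= x <= q ->
  exists2 i, (i < k)%N & a i <= x <= a i.+1.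
Proof.
move=> /andP[px xq].
have ex0 : exists j, (j < k)%N && (a j <= x).
  by exists 0%N; rewrite (zz_pos zz) (zz_start zz).
have bnd j : (j < k)%N && (a j <= x) -> (j <= k)%N by case/andP=> /ltnW.
case: (ex_maxnP ex0 bnd) => i /andP[ik aix] imax.
exists i; rewrite // aix /=.
have [->|ne] := eqVneq i.+1 k; first by rewrite (zz_stop zz).
rewrite leNgt; apply/negP => /ltW lt.
have : (i.+1 <= i)%N by apply: imax; rewrite lt; lia.
by rewrite ltnn.
Qed.

(** Sampling on both sides of an inner turning point exhibits a strict local
extremum, which is what excludes monotonicity across it. *)
Lemma zigzag_turn i x y : (0 < i < k)%N -> x < a i < y ->
  exists u w, [/\ x <= u < a i, a i < w <= y &
    (f u < f (a i) /\ f w < f (a i)) \/ (f (a i) < f u /\ f (a i) < f w)].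
Proof.
case: i => // i /andP[_ ik] /andP[xi iy].
have i1 := zz_lt zz (ltnW ik); have i2 := zz_lt zz ik.
exists (Num.max x (a i)), (Num.min y (a i.+2)).
have [xu aiu uai] : [/\ x <= Num.max x (a i), a i <= Num.max x (a i) &
   Num.max x (a i) < a i.+1] by rewrite !le_max gt_max !lexx orbT xi.
have [wy wai aiw] : [/\ Num.min y (a i.+2) <= y, Num.min y (a i.+2) <= a i.+2 &
   a i.+1 < Num.min y (a i.+2)] by rewrite !ge_min lt_min !lexx orbT iy.
rewrite xu wy uai aiw; split=> //.
have := zz_mono zz (ltnW ik) aiu uai (lexx _).
have := zz_mono zz ik (lexx _) aiw wai.
by rewrite /= addbN; case: addb => /= h1 h2; [right|left].
Qed.

End ZigzagTheory.

Lemma monotone_onP (R : realType) (I : set R) (f : R -> R) :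
  monotone_on I f <->
  (forall x y, I x -> I y -> x <= y -> f x <= f y) \/
  (forall x y, I x -> I y -> x <= y -> f y <= f x).
Proof.
split=> -[H|H]; [left|right|left|right] => x y.
- by move=> Ix Iy; apply: H; rewrite inE.
- by move=> Ix Iy; apply: H; rewrite inE.
- by rewrite !inE => Ix Iy; apply: H.
- by rewrite !inE => Ix Iy; apply: H.
Qed.

Lemma monotone_no_turn (R : realType) (f : R -> R) (p q : R) k a b
    (I : set R) i x y :
  zigzag f p q k a b -> is_interval I -> monotone_on I f ->
  (0 < i < k)%N -> I x -> I y -> ~ x < a i < y.
Proof.
move=> zz Iint /monotone_onP Imon ik Ix Iy xy.
have [u [w [xu wy H]]] := zigzag_turn zz ik xy.
have Iu : I u by apply: (Iint x y) => //; lra.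
have Iw : I w by apply: (Iint x y) => //; lra.
have Ia : I (a i) by apply: (Iint x y) => //; lra.
case: Imon => M; have := M u (a i) Iu Ia; have := M (a i) w Ia Iw; lra.
Qed.

(** A monotonicity interval cannot cross a turning point, so it lies in a lap,
while a lap cannot be enlarged without crossing one. *)
Lemma zigzag_card (R : realType) (f : R -> R) k a b :
  zigzag f 0 1 k a b -> (maximal_monotonicity_intervals f #= `I_k)%card.
Proof.
move=> zz; pose lap i := `[a i, a i.+1]%classic.
have lapE i x : lap i x = (a i <= x <= a i.+1) by rewrite /lap /= in_itv.
have lap_mono i : (i < k)%N -> monotonicity_interval f (lap i).
  move=> ik; split.
  - exact: interval_is_interval.
  - move=> x; rewrite lapE /= in_itv /= => xi.
    have := zigzag_bounds zz (ltnW ik); have := zigzag_bounds zz ik; lra.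
  - apply/monotone_onP; have := zz_mono zz ik.
    case: addb => /= M; [right|left] => x y; rewrite !lapE => xl yl;
      rewrite le_eqVlt => /orP[/eqP->//|xy]; apply/ltW/M => //; lra.
have lap_max i : (i < k)%N -> maximal_monotonicity_intervals f (lap i).
  move=> ik; split; first exact: lap_mono.
  move=> J [Jint J01 Jm] [sub nsub]; apply: nsub => z Jz; rewrite lapE.
  have Jl : J (a i) by apply: sub; rewrite lapE lexx ltW // (zz_lt zz).
  have Jr : J (a i.+1) by apply: sub; rewrite lapE lexx ltW // (zz_lt zz).
  have lt := zz_lt zz ik.
  have := J01 _ Jz; rewrite /= in_itv /= => z01.
  apply/andP; split; rewrite leNgt; apply/negP => h.
  - case: (posnP i) => i0; first by move: h; rewrite i0 (zz_start zz); lra.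
    by apply: (monotone_no_turn zz Jint Jm (i := i) _ Jz Jr); lia || lra.
  - have [ki|i1k] := leqP k i.+1.
      have E : k = i.+1 by lia.
      by have := zz_stop zz; rewrite E; lra.
    by apply: (monotone_no_turn zz Jint Jm (i := i.+1) _ Jl Jz); lia || lra.
suff -> : maximal_monotonicity_intervals f = lap @` `I_k.
  apply: inj_card_eq => i j; rewrite !inE /= => ik jk E.
  have := zz_lt zz ik; have := zz_lt zz jk.
  have : lap j (a i) by rewrite -E lapE lexx ltW // (zz_lt zz).
  have : lap i (a j) by rewrite E lapE lexx ltW // (zz_lt zz).
  rewrite !lapE; case: (ltngtP i j) => // h.
  - by have := zigzag_leq zz (h : i.+1 <= j)%N (ltnW jk); clear E => *; exfalso; lra.
  - by have := zigzag_leq zz (h : j.+1 <= i)%N (ltnW ik); clear E => *; exfalso; lra.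
rewrite eqEsubset; split=> [I [[Iint I01 Im] Imax]|_ [i /= ik <-]]; last exact: lap_max.
(* The lap starts at the last turning point that is a lower bound of I. *)
suff [i ik sub] : exists2 i, (i < k)%N & I `<=` lap i.
  exists i => //; apply: contrapT => ne; apply: (Imax (lap i)); first exact: lap_mono.
  by split=> // sub'; apply: ne; rewrite eqEsubset.
have ex0 : exists j, (j < k)%N && `[< forall x, I x -> a j <= x >].
  exists 0%N; rewrite (zz_pos zz) /=; apply/asboolP => x /I01.
  by rewrite /= in_itv /= (zz_start zz); lra.
have bnd j : (j < k)%N && `[< forall x, I x -> a j <= x >] -> (j <= k)%N.
  by case/andP=> /ltnW.
case: (ex_maxnP ex0 bnd) => i /andP[ik /asboolP aI] imax.
exists i => // x Ix; rewrite lapE aI //=.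
have [ki|i1k] := leqP k i.+1.
  have -> : i.+1 = k by lia.
  by rewrite (zz_stop zz); have := I01 _ Ix; rewrite /= in_itv /=; lra.
rewrite leNgt; apply/negP => h.
suff : (i.+1 <= i)%N by rewrite ltnn.
apply: imax; rewrite i1k /=; apply/asboolP => y Iy; rewrite leNgt; apply/negP => h2.
by apply: (monotone_no_turn zz Iint Im (i := i.+1) _ Iy Ix); lia || lra.
Qed.

(** * A commuting map is nowhere locally constant *)

Definition flat (R : realType) (f : R -> R) (x : R) : Prop :=
  exists2 d, 0 < d & forall y, 0 <= y <= 1 -> `|y - x| < d -> f y = f x.

(** The boundary in [0, 1] of the set of points where f is locally constant. *)
Definition flat_edge (R : realType) (f : R -> R) (x : R) : Prop :=
  [/\ 0 <= x <= 1, ~ flat f x &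
      forall d, 0 < d -> exists y, [/\ 0 <= y <= 1, `|y - x| < d & flat f y]].

Lemma flat_nearby (R : realType) (f : R -> R) x : 0 <= x <= 1 -> flat f x ->
  exists2 d, 0 < d &
    forall y, 0 <= y <= 1 -> `|y - x| < d -> flat f y /\ f y = f x.
Proof.
move=> x01 [d d0 H]; exists d => // y y01 yx; split; last exact: H.
exists (d - `|y - x|); first lra.
move=> z z01 zy; rewrite !H //.
by have := ler_distD y z x; lra.
Qed.

(** The points where f is locally constant with value f x form a relatively open
and closed subset of [0, 1], by connectedness all of it. *)
Lemma flat_without_edge (R : realType) (f : R -> R) x :
  (forall y, ~ flat_edge f y) -> 0 <= x <= 1 -> flat f x ->
  forall y, 0 <= y <= 1 -> f y = f x.
Proof.
move=> noedge x01 fx.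
pose B := [set y | [/\ 0 <= y <= 1, flat f y & f y = f x]].
suff BE : B = `[0, 1]%classic.
  by move=> y y01; have : B y by [rewrite BE /= in_itv]; case.
have /(connected_intervalP (`[0, 1] : set R)) conn : is_interval (`[0, 1]%classic : set R).
  exact: interval_is_interval.
apply: conn; first by exists x.
- exists [set z | exists2 d, 0 < d & forall y, 0 <= y <= 1 -> `|y - z| < d -> B y].
    rewrite openE => z [d d0 H]; exists (d / 2) => /=; first lra.
    move=> w /= zw; exists (d / 2); first lra.
    move=> y y01 yw; apply: H => //; have := ler_distD w y z.
    by rewrite (distrC w z); lra.
  rewrite eqEsubset; split=> y.
    move=> [y01 fy fxy]; split; first by rewrite /= in_itv.
    have [d d0 H] := flat_nearby y01 fy; exists d => // z z01 zy.
    by have [fz fzy] := H z z01 zy; split; rewrite ?fzy.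
  by move=> [/=]; rewrite in_itv /= => y01 [d d0]; apply; rewrite // subrr normr0.
- exists (closure B); first exact: closed_closure.
  rewrite eqEsubset; split=> y.
    by move=> By; split; [case: By => + _ _; rewrite /= in_itv | exact: subset_closure].
  move=> [/=]; rewrite in_itv /= => y01 cy.
  have near d : 0 < d -> exists z, B z /\ `|z - y| < d.
    move=> d0; have [z [Bz /=]] := cy (ball y d) (nbhsx_ballx _ _ d0).
    by move=> zy; exists z; split=> //; rewrite distrC.
  have fy : flat f y.
    apply: contrapT => nfy; apply: (noedge y); split=> // d /near[z [[z01 fz _] zy]].
    by exists z.
  split=> //; have [d d0 H] := fy; have [z [[z01 _ fz] zy]] := near d d0.
  by rewrite -(H z z01 zy).
Qed.

(** Between two consecutive break points f is affine, hence locally constant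
everywhere or nowhere. *)
Lemma flat_edge_finite (R : realType) (f : R -> R) : piecewise_linear f ->
  exists s : seq R, forall x, flat_edge f x -> x \in s.
Proof.
move=> /piecewise_linear_breaks[n [e [e0 en e01 elt eaff]]].
exists [seq e i | i <- iota 0 n.+1] => x [x01 nfx nearx].
apply: contrapT => /negP xs.
have xe i : (i <= n)%N -> x < e i \/ e i < x.
  move=> i_n; apply/orP; rewrite -neq_lt; apply/negP => /eqP E.
  by move/negP: xs; apply; apply/mapP; exists i; rewrite // mem_iota.
have [i i_n xi] : exists2 i, (i < n)%N & e i < x < e i.+1.
  have ex0 : exists j, (j <= n)%N && (e j < x).
    by exists 0%N; rewrite leq0n /=; have := xe 0%N isT; rewrite e0; lra.
  have bnd j : (j <= n)%N && (e j < x) -> (j <= n)%N by case/andP.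
  case: (ex_maxnP ex0 bnd) => i /andP[i_n eix] imax.
  have [ni|i_n'] := leqP n i.
    have E : i = n by lia.
    by move: eix; rewrite E en => ?; exfalso; lra.
  exists i; rewrite // eix /= ltNge; apply/negP => h.
  suff : (i.+1 <= i)%N by rewrite ltnn.
  by apply: imax; rewrite i_n' /=; have := xe i.+1 i_n'; lra.
have [|||d [d0 d1 d2 _]] := @small_pos3 R (x - e i) (e i.+1 - x) 1; try lra.
have [y [y01 yx [c c0 fy]]] := nearx d d0.
have [a [b ab]] := eaff i i_n.
move: yx; rewrite ltr_distl => yx.
have ein : 0 <= e i /\ e i.+1 <= 1.
  by have := e01 i (ltnW i_n); have := e01 _ i_n; lra.
have [||u [u0 uc ui _]] := @small_pos3 R c (e i.+1 - y) 1 c0; try lra.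
have : f (y + u) = f y.
  apply: fy; first lra.
  by rewrite addrC addKr gtr0_norm.
rewrite !ab; try lra; move=> au.
have a0 : a = 0.
  have : a * u = 0 by lra.
  by move/eqP; rewrite mulf_eq0 => /orP[/eqP//|/eqP]; lra.
apply: nfx; exists d; first by [].
move=> z z01; rewrite ltr_distl => zx; rewrite !ab ?a0 ?mul0r //; lra.
Qed.

(** On a finite stable set the injections l and r are both onto, so its points lie
in [0, v] and in [v, 1] at once: the only candidate is v, and l v <> v because
g v = 1. *)
Lemma stable_finite_empty (R : realType) (g l r : R -> R) (v : R) (s : seq R)
    (B : R -> Prop) :
  branches g v l r -> (forall x, B x -> x \in s) ->
  (forall x, B x -> [/\ 0 <= x <= 1, B (l x) & B (r x)]) -> forall x, ~ B x.
Proof.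
move=> br Bs Blr x Bx.
pose t := [seq x <- undup s | `[< B x >]].
have tE y : (y \in t) = `[< B y >].
  rewrite mem_filter mem_undup; apply/andb_idr => /asboolP; exact: Bs.
have ut : uniq t by rewrite filter_uniq ?undup_uniq.
have t01 y : y \in t -> 0 <= y <= 1 by rewrite tE => /asboolP/Blr[].
have onto h g' : (forall y, B y -> B (h y)) ->
    (forall y, 0 <= y <= 1 -> g' (h y) = y) -> forall y, B y -> exists2 z, B z & y = h z.
  move=> Bh hK y By.
  have um : uniq (map h t).
    rewrite map_inj_in_uniq // => z w /t01 z01 /t01 w01 E.
    by rewrite -(hK _ z01) E hK.
  have sm : {subset map h t <= t}.
    by move=> _ /mapP[z + ->]; rewrite !tE => /asboolP/Bh Bz; apply/asboolP.
  have [|_ E] := uniq_min_size um sm _; first by rewrite size_map.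
  have : y \in map h t by rewrite E tE; apply/asboolP.
  by move=> /mapP[z + ->]; rewrite tE => /asboolP; exists z.
have Bv y : B y -> y = v.
  move=> By.
  have [z /Blr[z01 _ _] yz] : exists2 z, B z & y = l z.
    by apply: (onto l g _ (left_inv br)) => // z /Blr[].
  have [w /Blr[w01 _ _] yw] : exists2 z, B z & y = r z.
    by apply: (onto r g _ (right_inv br)) => // w /Blr[].
  have := left_in br z01; have := right_in br w01; lra.
have [x01 Bl _] := Blr _ Bx.
have := left_inv br x01; rewrite (Bv _ Bl) (Bv _ Bx) (peak_val br).
by have := peak01 br; lra.
Qed.

Section NowhereFlat.
Variables (R : realType) (g l r psi : R -> R) (v : R).
Hypothesis br : branches g v l r.
Hypothesis psi_in : forall x, 0 <= x <= 1 -> 0 <= psi x <= 1.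
Hypothesis psi_cont : cont_on 0 1 psi.
Hypothesis psi_g : forall x, 0 <= x <= 1 -> psi (g x) = g (psi x).

(** On either side of v the map g is injective, and v is alone in its fiber. *)
Lemma fiber_discrete c : 0 <= c <= 1 -> exists2 e, 0 < e &
  forall w, 0 <= w <= 1 -> g w = g c -> `|w - c| < e -> w = c.
Proof.
move=> c01; case: (ltgtP c v) => cv.
- exists (v - c); first lra.
  move=> w w01 E; rewrite ltr_distl => wc.
  have [wI cI] : 0 <= w <= v /\ 0 <= c <= v by lra.
  by rewrite -(left_g br wI) E (left_g br cI).
- exists (c - v); first lra.
  move=> w w01 E; rewrite ltr_distl => wc.
  have [wI cI] : v <= w <= 1 /\ v <= c <= 1 by lra.
  by rewrite -(right_g br wI) E (right_g br cI).
- exists 1 => // w w01; rewrite cv (peak_val br) => E _.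
  have := peak01 br; have := peak_val br.
  case: (ltgtP w v) => // wv.
  + by have := @g_incr _ _ _ _ _ br w v; lra.
  + by have := @g_decr _ _ _ _ _ br v w; lra.
Qed.

(** g is an open map of [0, 1], by continuity of the inverse branches. *)
Lemma lift_nearby x e : 0 <= x <= 1 -> 0 < e -> exists2 d, 0 < d &
  forall y, 0 <= y <= 1 -> `|y - g x| < d ->
  exists z, [/\ 0 <= z <= 1, `|z - x| < e & g z = y].
Proof.
move=> x01 e0; have gx01 := g_in br x01; have v01 := peak01 br.
have [xv|vx] := leP x v.
- have [d d0 H] := left_cont br gx01 e0; exists d => // y y01 yx.
  exists (l y); rewrite (left_inv br) //; split=> //.
    by have := left_in br y01; lra.
  have xI : 0 <= x <= v by lra.
  by rewrite -[X in _ - X](left_g br xI); apply: H.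
- have [d d0 H] := right_cont br gx01 e0; exists d => // y y01 yx.
  exists (r y); rewrite (right_inv br) //; split=> //.
    by have := right_in br y01; lra.
  have xI : v <= x <= 1 by lra.
  by rewrite -[X in _ - X](right_g br xI); apply: H.
Qed.

Lemma flat_image x : 0 <= x <= 1 -> flat psi x -> flat psi (g x).
Proof.
move=> x01 [e e0 H]; have [d d0 L] := lift_nearby x01 e0.
exists d => // y y01 /(L y y01)[z [z01 zx <-]].
by rewrite !psi_g // H.
Qed.

(** Near x the values of psi lie in one fiber of g and stay close to psi x, so they
equal psi x since fibers are discrete. *)
Lemma flat_preimage x : 0 <= x <= 1 -> flat psi (g x) -> flat psi x.
Proof.
move=> x01 [e e0 H].
have [u u0 U] := fiber_discrete (psi_in x01).
have [d1 d10 D1] := g_cont br x01 e0.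
have [d2 d20 D2] := psi_cont x01 u0.
have [d [d0 dd1 dd2 _]] := small_pos3 d10 d20 d20.
exists d => // y y01 yx; apply: U; first exact: psi_in.
- rewrite -!psi_g //; apply: H; first exact: g_in br _ _.
  by apply: D1 => //; lra.
- by apply: D2 => //; lra.
Qed.

Lemma flat_edge_lift h : (forall y, 0 <= y <= 1 -> 0 <= h y <= 1) ->
  (forall y, 0 <= y <= 1 -> g (h y) = y) -> cont_on 0 1 h ->
  forall x, flat_edge psi x -> flat_edge psi (h x).
Proof.
move=> h01 hK hc x [x01 nfx near]; split; first exact: h01.
- by move=> /(flat_image (h01 _ x01)); rewrite hK.
- move=> d d0; have [d' d'0 H] := hc _ x01 d d0.
  have [y [y01 yx fy]] := near d' d'0; exists (h y); split; [exact: h01|exact: H|].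
  by apply: flat_preimage; rewrite ?hK //; apply: h01.
Qed.

Lemma nowhere_flat : piecewise_linear psi -> nonconstant01 psi ->
  forall x, 0 <= x <= 1 -> ~ flat psi x.
Proof.
move=> /flat_edge_finite[s sP] nc x x01 fx; apply: nc.
have v01 := peak01 br.
exists (psi x) => y; rewrite /= in_itv /= => y01.
apply: flat_without_edge fx _ y01 => //; apply: stable_finite_empty br sP _ => z ez.
split; first by case: ez.
- apply: flat_edge_lift ez; [|exact: left_inv br|exact: left_cont br].
  by move=> w /(left_in br); lra.
- apply: flat_edge_lift ez; [|exact: right_inv br|exact: right_cont br].
  by move=> w /(right_in br); lra.
Qed.

End NowhereFlat.

(** * Turning points of psi o g and of g o psi *)

Lemma nowhere_flat_zigzag (R : realType) (f : R -> R) :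
  piecewise_linear f -> (forall x, 0 <= x <= 1 -> ~ flat f x) ->
  exists k a b, zigzag f 0 1 k a b.
Proof.
move=> /piecewise_linear_breaks[n [e [e0 en e01 elt eaff]]] nfl.
rewrite -e0 -en; apply: zigzag_of_pieces => //.
  by case: (posnP n) => // n0; move: en; rewrite n0 e0 => /eqP; rewrite eq_sym oner_eq0.
move=> i i_n; have [a [b ab]] := eaff i i_n.
have lt := elt i i_n; have ei := e01 i (ltnW i_n); have ei1 := e01 _ i_n.
case: (ltgtP a 0) => a0.
- exists true => u w eu uw we; rewrite !ab; try lra.
  by have : a * w < a * u; [rewrite ltr_nM2l | lra].
- exists false => u w eu uw we; rewrite !ab; try lra.
  by have : a * u < a * w; [rewrite ltr_pM2l | lra].
- case: (nfl ((e i + e i.+1) / 2)); first lra.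
  exists ((e i.+1 - e i) / 2); first lra.
  move=> y _; rewrite ltr_distl => yx; rewrite !ab ?a0 ?mul0r //; lra.
Qed.

Lemma zigzag_ext (R : realType) (f h : R -> R) (p q : R) k a b :
  (forall x, p <= x <= q -> f x = h x) -> zigzag f p q k a b -> zigzag h p q k a b.
Proof.
move=> fh zz; case: (zz) => k0 a0 ak alt am; split=> // i ik u w ui uw wi.
have := zigzag_bounds zz (ltnW ik); have := zigzag_bounds zz ik => A B.
by rewrite -!fh; [exact: am | lra | lra].
Qed.

Lemma strict_mono_no_turn (R : realType) (f : R -> R) (p q : R) k a b i d x y :
  zigzag f p q k a b -> (0 < i < k)%N -> strict_mono d f x y -> ~ x < a i < y.
Proof.
move=> zz ik fxy xy; have [u [w [xu wy turn]]] := zigzag_turn zz ik xy.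
have [[xu1 ua] [aw wy1]] : (x <= u /\ u < a i) /\ (a i < w /\ w <= y) by lra.
have := fxy _ _ xu1 ua (ltW (lt_le_trans aw wy1)).
have := fxy _ _ (ltW (le_lt_trans xu1 ua)) aw wy1.
by case: d {fxy}; lra.
Qed.

(** Reflecting lap i of a zigzag with k + k laps gives lap k + k - i.+1. *)
Lemma mirror_parity k i : (i < k)%N -> ~~ odd k ->
  odd (k + k - i.+1) = ~~ odd i /\ odd (k + k - i.+1)./2 = ~~ odd i./2.
Proof. lia. Qed.

Section Folding.
Variables (R : realType) (g l r psi : R -> R) (v : R) (k : nat) (a : nat -> R).
Variable b : bool.
Hypothesis br : branches g v l r.
Hypothesis psi_in : forall x, 0 <= x <= 1 -> 0 <= psi x <= 1.
Hypothesis psi_cont : cont_on 0 1 psi.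
Hypothesis psi_g : forall x, 0 <= x <= 1 -> psi (g x) = g (psi x).
Hypothesis zz : zigzag psi 0 1 k a b.

(** The preimages under g of the turning points of psi, in increasing order. *)
Definition fold i := if (i <= k)%N then l (a i) else r (a (k + k - i)%N).

Lemma left_lap i : (i < k)%N -> strict_mono (b (+) odd i) (psi \o g) (l (a i)) (l (a i.+1)).
Proof.
move=> ik u w lu uw wl /=.
have A := zigzag_bounds zz (ltnW ik); have B := zigzag_bounds zz ik.
have := left_in br A; have := left_in br B; have v01 := peak01 br => C D.
have gu : a i <= g u.
  rewrite -(left_inv br A); move: lu; rewrite le_eqVlt => /orP[/eqP->//|lu].
  by apply/ltW/(g_incr br) => //; lra.
have gw : g w <= a i.+1.
  rewrite -(left_inv br B); move: wl; rewrite le_eqVlt => /orP[/eqP->//|wl].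
  by apply/ltW/(g_incr br) => //; lra.
by apply: (zz_mono zz ik) => //; apply: (g_incr br) => //; lra.
Qed.

Lemma right_lap i : (i < k)%N ->
  strict_mono (~~ (b (+) odd i)) (psi \o g) (r (a i.+1)) (r (a i)).
Proof.
move=> ik u w lu uw wl /=.
have A := zigzag_bounds zz (ltnW ik); have B := zigzag_bounds zz ik.
have := right_in br A; have := right_in br B; have v01 := peak01 br => C D.
have gw : a i <= g w.
  rewrite -(right_inv br A); move: wl; rewrite le_eqVlt => /orP[/eqP->//|wl].
  by apply/ltW/(g_decr br) => //; lra.
have gu : g u <= a i.+1.
  rewrite -(right_inv br B); move: lu; rewrite le_eqVlt => /orP[/eqP->//|lu].
  by apply/ltW/(g_decr br) => //; lra.
have guw : g w < g u by apply: (g_decr br) => //; lra.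
by have := zz_mono zz ik gw guw gu; case: addb.
Qed.

Lemma left1 : l 1 = v.
Proof. by rewrite -(peak_val br) (left_g br) //; have := peak01 br; lra. Qed.

Lemma right1 : r 1 = v.
Proof. by rewrite -(peak_val br) (right_g br) //; have := peak01 br; lra. Qed.

Lemma fold_left i : (i <= k)%N -> fold i = l (a i).
Proof. by rewrite /fold => ->. Qed.

Lemma fold_right i : (i <= k)%N -> fold (k + k - i) = r (a i).
Proof.
move=> ik; rewrite /fold; case: leqP => h; last by congr (r (a _)); lia.
have E : i = k by lia.
by rewrite E addnK (zz_stop zz) left1 right1.
Qed.

Lemma fold_zigzag : zigzag (psi \o g) 0 1 (k + k) fold b.
Proof.
have v01 := peak01 br; have k0 := zz_pos zz.
have idx i : (i < k + k)%N -> (i < k)%N \/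
    exists j, [/\ (j < k)%N, i = (k + k - j.+1)%N & i.+1 = (k + k - j)%N].
  by move=> ikk; case: (ltnP i k) => ik; [left | right; exists (k + k - i.+1)%N; split; lia].
split.
- by rewrite addn_gt0 k0.
- by rewrite fold_left // (zz_start zz) -(g_zero br) (left_g br) ?(g_zero br) //; lra.
- rewrite -[X in fold X]subn0 fold_right // (zz_start zz) -(g_one br) (right_g br) //; lra.
- move=> i /idx[ik|[j [jk -> ->]]].
    rewrite !fold_left ?(ltnW ik) //.
    have := zigzag_bounds zz (ltnW ik); have := zigzag_bounds zz ik => A B.
    by apply: (left_incr br); [lra | exact: zz_lt zz _ _ | lra].
  rewrite !fold_right ?(ltnW jk) //.
  have := zigzag_bounds zz (ltnW jk); have := zigzag_bounds zz jk => A B.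
  by apply: (right_decr br); [lra | exact: zz_lt zz _ _ | lra].
- move=> i /idx[ik|[j [jk E1 E2]]].
    by rewrite !fold_left ?(ltnW ik) //; apply: left_lap.
  rewrite E2 {2}E1 !fold_right ?(ltnW jk) // (_ : b (+) odd i = ~~ (b (+) odd j)).
    exact: right_lap.
  by rewrite E1 oddB /= ?oddD ?addbb ?addbN; lia.
Qed.

(** Away from psi = v, g is strictly monotone near the value of psi, so g \o psi
cannot turn where psi does not. *)
Lemma turn_over_peak m c b' j x y d : zigzag (g \o psi) 0 1 m c b' ->
  (0 < j < m)%N -> 0 <= x -> y <= 1 -> strict_mono d psi x y -> x < c j < y ->
  psi (c j) = v.
Proof.
move=> zc jm x0 y1 pxy xcy; apply/eqP/negPn/negP => /eqP ne.
have c01 : 0 <= c j <= 1 by lra.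
have e0 : 0 < `|psi (c j) - v| by rewrite normr_gt0 subr_eq0; apply/eqP.
have [e' e'0 He] := psi_cont c01 e0.
have [||u [u0 ue ux uy]] := small_pos3 (a := e') (b := c j - x) (c := y - c j) e'0; try lra.
have near z : c j - u <= z <= c j + u ->
    0 <= psi z <= 1 /\ `|psi z - psi (c j)| < `|psi (c j) - v|.
  move=> zu; have z01 : 0 <= z <= 1 by lra.
  by split; [exact: psi_in | apply: He => //; rewrite ltr_distl; lra].
suff [d' M] : exists d', strict_mono d' (g \o psi) (c j - u) (c j + u).
  by apply: (strict_mono_no_turn zc jm M); lra.
have [cv|vc] : psi (c j) < v \/ v < psi (c j).
  by apply/orP; rewrite -neq_lt; apply/eqP.
- exists d => z w uz zw wu /=.
  have [xz wy] : x <= z /\ w <= y by lra.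
  have [|z01] := near z; first lra.
  have [|w01] := near w; first lra.
  rewrite (ltr0_norm (x := psi (c j) - v)) ?subr_lt0 // !ltr_distl => wn zn.
  by have := pxy z w xz zw wy; case: (d) => /= H; apply: (g_incr br) => //; lra.
- exists (~~ d) => z w uz zw wu /=.
  have [xz wy] : x <= z /\ w <= y by lra.
  have [|z01] := near z; first lra.
  have [|w01] := near w; first lra.
  rewrite (gtr0_norm (x := psi (c j) - v)) ?subr_gt0 // !ltr_distl => wn zn.
  by have := pxy z w xz zw wy; case: (d) => /= H; apply: (g_decr br) => //; lra.
Qed.

Lemma fold_zigzag_gpsi : zigzag (g \o psi) 0 1 (k + k) fold b.
Proof. exact: zigzag_ext psi_g fold_zigzag. Qed.

(** At two such points psi would take the value v twice in one lap. *)
Lemma one_fold_per_lap i j : (i < k)%N -> (0 < j)%N -> (j.+1 < k + k)%N ->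
  a i < fold j -> fold j.+1 < a i.+1 -> False.
Proof.
move=> ik j0 jk h1 h2; have zc := fold_zigzag_gpsi.
have lt := zz_lt zc (ltnW jk).
have A := zigzag_bounds zz (ltnW ik); have B := zigzag_bounds zz ik.
have am := zz_mono zz ik.
have [a0 a1] : 0 <= a i /\ a i.+1 <= 1 by lra.
have j1 : (0 < j < k + k)%N by clear -j0 jk; lia.
have P1 : psi (fold j) = v by apply: turn_over_peak zc j1 a0 a1 am _; lra.
have j2 : (0 < j.+1 < k + k)%N by clear -jk; lia.
have P2 : psi (fold j.+1) = v by apply: turn_over_peak zc j2 a0 a1 am _; lra.
have := am (fold j) (fold j.+1) (ltW h1) lt (ltW h2).
by rewrite P1 P2 ltxx; case: addb.
Qed.

(** Since no lap of psi contains two consecutive turning points of g \o psi in its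
interior, a j <= fold (2 j) by induction from the left end, and fold (2 j) <= a j
by induction from the right end. *)
Lemma fold_even j : (j <= k)%N -> fold (j + j) = a j.
Proof.
have zc := fold_zigzag_gpsi; move=> jk; apply/eqP; rewrite eq_le; apply/andP; split.
- have up m : (m <= k)%N -> fold ((k - m) + (k - m)) <= a (k - m)%N.
    elim: m => [|m IH] mk; first by rewrite subn0 (zz_stop zz) (zz_stop zc).
    have := IH (ltnW mk); have -> : (k - m)%N = (k - m.+1).+1 by lia.
    set i := (k - m.+1)%N => H; rewrite leNgt; apply/negP => h.
    have [i0|i0] := posnP i.
      by move: h; rewrite i0 (zz_start zz) (zz_start zc) ltxx.
    have l2 : fold (i + i).+1 < fold (i.+1 + i.+1).
      by apply: (zigzag_ltn zc); lia.
    by apply: (@one_fold_per_lap i (i + i)); lia || lra.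
  by have := up (k - j)%N (leq_subr _ _); rewrite subKn.
- elim: j jk => [|j IH] jk; first by rewrite (zz_start zz) (zz_start zc).
  have H := IH (ltnW jk); rewrite leNgt; apply/negP => h.
  have [kj|jk'] := leqP k j.+1.
    have E : j.+1 = k by lia.
    by move: h; rewrite E (zz_stop zz) (zz_stop zc) ltxx.
  have l2 : fold (j + j) < fold (j + j).+1 by apply: (zigzag_ltn zc); lia.
  apply: (@one_fold_per_lap j (j + j).+1); try lia; first lra.
  by have -> : (j + j).+2 = (j.+1 + j.+1)%N by lia.
Qed.

Lemma fold_odd j : (j < k)%N -> psi (fold (j + j).+1) = v.
Proof.
move=> jk; have zc := fold_zigzag_gpsi.
have A := zigzag_bounds zz (ltnW jk); have B := zigzag_bounds zz jk.
have [a0 a1] : 0 <= a j /\ a j.+1 <= 1 by lra.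
have j1 : (0 < (j + j).+1 < k + k)%N by clear -jk; lia.
apply: (turn_over_peak zc j1 a0 a1 (zz_mono zz jk)).
rewrite -(fold_even (ltnW jk)) -(fold_even jk).
by rewrite !(zigzag_ltn zc) //; lia.
Qed.

(** Each lap of g \o psi is one of the two halves of a lap of psi, cut where psi
crosses v. The direction of the lap of psi is b + (i / 2) modulo 2, and the
parity of i tells the first half from the second. *)
Lemma side_of_peak i x : (i < k + k)%N -> fold i <= x <= fold i.+1 ->
  if b (+) odd i./2 (+) odd i then v <= psi x else psi x <= v.
Proof.
move=> ik xi; set j := i./2.
have jk : (j < k)%N by rewrite /j; lia.
have P := fold_odd jk; have am := zz_mono zz jk.
have c0 := fold_even (ltnW jk); have c1 := fold_even jk.
have zc := fold_zigzag_gpsi.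
have l1 : a j < fold (j + j).+1 by rewrite -c0; apply: (zigzag_ltn zc); lia.
have l2 : fold (j + j).+1 < a j.+1 by rewrite -c1; apply: (zigzag_ltn zc); lia.
have iE : i = (j + j + odd i)%N by rewrite addnn addnC odd_double_half.
move: xi; rewrite iE; case: (odd i); rewrite ?addn1 ?addn0 => xi.
- have {xi} [x1 x2] : fold (j + j).+1 <= x /\ x <= a j.+1.
    by rewrite -c1 (_ : (j.+1 + j.+1 = (j + j).+2)%N); [lra|lia].
  move: x1; rewrite /= oddD addbb addbT le_eqVlt => /orP[/eqP <-|x1].
    by rewrite P; case: ifP.
  by have := am _ _ (ltW l1) x1 x2; rewrite P; case: addb => /= ?; apply: ltW.
- have {xi} [x1 x2] : a j <= x /\ x <= fold (j + j).+1.
    by rewrite -c0; lra.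
  move: x2; rewrite /= oddD addbb addbF le_eqVlt => /orP[/eqP ->|x2].
    by rewrite P; case: ifP.
  by have := am _ _ x1 x2 (ltW l2); rewrite P; case: addb => /= ?; apply: ltW.
Qed.

(** Mirror laps lie on the same side of v when k is even, because both the
direction of psi and the half of its lap are switched. *)
Lemma even_fold_symmetric : ~~ odd k ->
  forall y, 0 <= y <= 1 -> psi (l y) = psi (r y).
Proof.
move=> ek y y01; have [i ik yi] := zigzag_locate zz y01.
have A := zigzag_bounds zz (ltnW ik); have B := zigzag_bounds zz ik.
have ly : fold i <= l y <= fold i.+1.
  by rewrite !fold_left ?(ltnW ik) //; apply/andP; split; apply: (left_le br); lra.
have ry : fold (k + k - i.+1) <= r y <= fold (k + k - i.+1).+1.
  rewrite (_ : (k + k - i.+1).+1 = (k + k - i)%N); last by clear -ik; lia.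
  by rewrite !fold_right ?(ltnW ik) //; apply/andP; split; apply: (right_le br); lra.
have ik2 : (i < k + k)%N by clear -ik; lia.
have ik3 : (k + k - i.+1 < k + k)%N by clear -ik; lia.
have := side_of_peak ik2 ly; have := side_of_peak ik3 ry.
have [-> ->] := mirror_parity ik ek.
rewrite !(addbN, addNb) negbK.
have v01 := peak01 br; have Il := left_in br y01; have Ir := right_in br y01.
have [l01 r01] : 0 <= l y <= 1 /\ 0 <= r y <= 1 by lra.
have pl := psi_in l01; have pr := psi_in r01.
have E : g (psi (l y)) = g (psi (r y)).
  by rewrite -!psi_g // (left_inv br) // (right_inv br).
case: addb => sr sl.
- have [Jl Jr] : v <= psi (l y) <= 1 /\ v <= psi (r y) <= 1 by lra.
  by rewrite -(right_g br Jl) E (right_g br Jr).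
- have [Jl Jr] : 0 <= psi (l y) <= v /\ 0 <= psi (r y) <= v by lra.
  by rewrite -(left_g br Jl) E (left_g br Jr).
Qed.

End Folding.

(** * The left factor psi o l *)

(** The pieces are the sets where l y lies in a given piece of g and in a given
piece of psi. There l is affine by inverting g. *)
Lemma piecewise_linear_left (R : realType) (g l r psi : R -> R) (v : R) :
  branches g v l r -> piecewise_linear g -> piecewise_linear psi ->
  piecewise_linear (psi \o l).
Proof.
move=> br [_ [n [I [Iint Iaff Icov]]]] [/cont_onP pc [m [J [Jint Jaff Jcov]]]].
have v01 := peak01 br.
have l01 y : 0 <= y <= 1 -> 0 <= l y <= 1 by move/(left_in br); lra.
split; first exact/cont_onP/(cont_on_comp pc (left_cont br)).
exists #|{: 'I_n * 'I_m}|, (fun i y => [/\ 0 <= y <= 1,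
  I (enum_val i).1 (l y) & J (enum_val i).2 (l y)]); split.
- move=> i x y [x01 Ix Jx] [y01 Iy Jy] z xzy.
  have lz : l x <= l z <= l y by apply/andP; split; apply: (left_le br); lra.
  by split; [lra | exact: Iint Ix Iy _ lz | exact: Jint Jx Jy _ lz].
- move=> i; case: (enum_val i) => i1 i2 /=.
  have [a [b gab]] := Iaff i1; have [c [d pcd]] := Jaff i2.
  have key y : 0 <= y <= 1 -> I i1 (l y) -> y = a * l y + b.
    by move=> y01 /gab; rewrite (left_inv br).
  (* If g has slope 0 on its piece, then y = g (l y) takes a single value. *)
  have [a0|a0] := eqVneq a 0.
    exists 0, (psi (l b)) => y [y01 Iy _].
    by have := key y y01 Iy; rewrite a0 mul0r add0r => ->; rewrite mul0r add0r.
  exists (c / a), (d - c * b / a) => y [y01 Iy /pcd /= ->].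
  by rewrite {2}(key y y01 Iy); field.
- rewrite eqEsubset; split=> y; first by move=> [i _ [y01 _ _]]; rewrite /= in_itv.
  rewrite /= in_itv /= => y01; have ly := l01 y y01.
  have : (\bigcup_i I i) (l y) by rewrite Icov /= in_itv.
  have : (\bigcup_i J i) (l y) by rewrite Jcov /= in_itv.
  move=> [j _ Jj] [i _ Ii]; exists (enum_rank (i, j)) => //=.
  by rewrite enum_rankK.
Qed.

Lemma left_factor_zigzag (R : realType) (g l r psi : R -> R) (v : R) t a b :
  branches g v l r -> zigzag psi 0 1 (t + t) a b -> a t = v ->
  zigzag (psi \o l) 0 1 t (g \o a) b.
Proof.
move=> br zz atv.
have v01 := peak01 br; have tt0 := zz_pos zz.
have av i : (i <= t)%N -> 0 <= a i <= v.
  move=> it; have := zigzag_leq zz it (leq_addr t t); rewrite atv => h.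
  have it2 : (i <= t + t)%N by lia.
  by have := zigzag_bounds zz it2; lra.
split; first lia.
- by rewrite /= (zz_start zz) (g_zero br).
- by rewrite /= atv (peak_val br).
- move=> i it; have it2 : (i < t + t)%N by lia.
  have := av i (ltnW it); have := av _ it => A B.
  by apply: (g_incr br); [lra | exact: zz_lt zz _ _ | lra].
- move=> i it; have it2 : (i < t + t)%N by lia.
  have A := av i (ltnW it); have B := av _ it => u w /= gu uw wg.
  have [Ga Gb] : 0 <= g (a i) <= 1 /\ 0 <= g (a i.+1) <= 1 by split; apply: (g_in br); lra.
  apply: (zz_mono zz it2).
  + rewrite -(left_g br A); move: gu; rewrite le_eqVlt => /orP[/eqP->//|gu].
    by apply/ltW/(left_incr br) => //; lra.
  + by apply: (left_incr br) => //; lra.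
  + rewrite -(left_g br B); move: wg; rewrite le_eqVlt => /orP[/eqP->//|wg].
    by apply/ltW/(left_incr br) => //; lra.
Qed.

Theorem proposition1 (R : realType) (g psi : R -> R) (t : nat)
  (g_pl : piecewise_linear g) (g_unimodal : unimodal g)
  (psi_map : self_map01 psi) (psi_pl : piecewise_linear psi)
  (psi_nc : nonconstant01 psi) (psi_g : commute01 psi g)
  (t_ge1 : (1 <= t)%N)
  (psi_2t : (maximal_monotonicity_intervals psi #= `I_(2 * t))%card) :
  exists psi' : R -> R,
    [/\ self_map01 psi', piecewise_linear psi', nonconstant01 psi',
        (maximal_monotonicity_intervals psi' #= `I_t)%card &
        commute01 psi' g].
Proof.
have [v [l [r br]]] := unimodal_branches g_unimodal.
have v01 := peak01 br.
have p01 x : 0 <= x <= 1 -> 0 <= psi x <= 1.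
  by move=> x01; have := psi_map x; rewrite /= !in_itv /=; apply.
have pg x : 0 <= x <= 1 -> psi (g x) = g (psi x).
  by move=> x01; have := psi_g x; rewrite /= in_itv /=; apply.
have pc : cont_on 0 1 psi by case: psi_pl => /cont_onP.
have nfl := nowhere_flat br p01 pc pg psi_pl psi_nc.
have [k [a [b zz]]] := nowhere_flat_zigzag psi_pl nfl.
have kE : k = (t + t)%N.
  rewrite addnn -mul2n; apply/card_eq_II.
  by apply: card_eq_trans psi_2t; rewrite card_eq_sym; exact: zigzag_card zz.
subst k.
have even : ~~ odd (t + t) by rewrite addnn odd_double.
have sym := even_fold_symmetric br p01 pc pg zz even.
have atv : a t = v.
  rewrite -(fold_even br p01 pc pg zz (leq_addr t t)) fold_left //.
  by rewrite (zz_stop zz) (left1 br).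
have zz' := left_factor_zigzag br zz atv.
have l01 y : 0 <= y <= 1 -> 0 <= l y <= 1 by move/(left_in br); lra.
have fac x : 0 <= x <= 1 -> psi (l (g x)) = psi x.
  move=> x01; have [xv|vx] := leP x v.
    by have xI : 0 <= x <= v by [lra]; rewrite (left_g br xI).
  have xI : v <= x <= 1 by lra.
  by rewrite sym ?(right_g br xI) //; apply: (g_in br).
exists (psi \o l); split.
- by move=> x; rewrite /= !in_itv /= => x01; apply/p01/l01.
- exact: piecewise_linear_left br g_pl psi_pl.
- move=> [c cst].
  have t0 := t_ge1.
  have := zz_mono zz' t0 (lexx _) (zz_lt zz' t0) (lexx _).
  have B1 := zigzag_bounds zz' t0; have B0 := zigzag_bounds zz' (leq0n t).
  by rewrite !cst /= ?in_itv //= ltxx; case: addb.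
- exact: zigzag_card zz'.
- move=> x; rewrite in_itv /= => x01.
  by rewrite fac // -pg ?l01 // (left_inv br).
Qed.
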